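(* If a function $f:\mathbb{N}\to\mathbb{R}^+$ satisfies $\Delta f>0$, $\Delta^2 f\ge0$, and $$\limsup_{x\to\infty} \frac{N(x)^2}{x}>18,$$ where $N(x):=|\{n\in\mathbb{N}\mid f(n)\le x\}|$, then the graph of $\{\lfloor f(n)\rfloor\}_{n=1}^\infty$ contains an arithmetic progression of length $4$.
   Context: $\mathbb{N}=\{1,2,\ldots\}$ and $\mathbb{R}^+=(0,\infty)$. $\Delta$ is the difference operator $\Delta f(n)=f(n+1)-f(n)$, and $\Delta^2=\Delta\circ\Delta$; the conditions $\Delta f>0$ and $\Delta^2f\ge0$ are required at every $n\in\mathbb{N}$. The graph of $\{\lfloor f(n)\rfloor\}_{n=1}^\infty$ is the set $\{(n,\lfloor f(n)\rfloor)\mid n\in\mathbb{N}\}$. A sequence $\{p(j)\}_{j=0}^{3}\subset\mathbb{N}^2$ is an arithmetic progression of length $4$ if there is $D\in\mathbb{N}^2$ (so both components of $D$ are positive) with $p(j)=p(0)+jD$ for $j=0,1,2,3$. $|X|$ is the cardinality of $X$. *)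

(* Defs.v *)
(* The positive integers {1, 2, ...} are the n : nat with
   (0 < n)%N; a function on them is a function on nat whose value at 0 is never
   used.  The difference operator f |-> (n |-> f n.+1 - f n) is the library's
   telescope. *)
From HB Require Import structures.
From mathcomp Require Import all_boot all_order all_algebra finmap.
From mathcomp Require Import all_classical all_reals all_analysis.

Set Implicit Arguments.
Unset Strict Implicit.
Unset Printing Implicit Defensive.

Import Order.TTheory GRing.Theory Num.Theory.
Import numFieldNormedType.Exports.

Local Open Scope classical_set_scope.
Local Open Scope ring_scope.

(* fset_set is only meaningful on finite sets; the set below is finite for
   every x as soon as f is strictly increasing and convex, because f is then
   unbounded. *)
Definition countN (R : realType) (f : nat -> R) (x : R) : nat :=
  #|` fset_set [set n : nat | (0 < n)%N /\ f n <= x] |%fset.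

Definition floor_graph (R : realType) (f : nat -> R) : set (int * int) :=
  [set (n%:Z, Num.floor (f n)) | n in [set n : nat | (0 < n)%N]].

Definition posZ2 : set (int * int) := [set z | 0 < z.1 /\ 0 < z.2].

(* D *+ j is computed in the product group int * int; for k > 0 the element a
   is the initial term of p. *)
Definition is_AP (k : nat) (p : 'I_k -> int * int) : Prop :=
  (forall j, posZ2 (p j)) /\
  exists a D : int * int, posZ2 D /\ forall j : 'I_k, p j = a + D *+ j.

Definition contains_AP (k : nat) (A : set (int * int)) : Prop :=
  exists p : 'I_k -> int * int, is_AP p /\ forall j, A (p j).

(* Main.v *)
Require Import Defs.
From HB Require Import structures.
From mathcomp Require Import all_boot all_order all_algebra finmap.
From mathcomp Require Import all_classical all_reals all_analysis.
From mathcomp Require Import zify lra.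

Set Implicit Arguments.
Unset Strict Implicit.
Unset Printing Implicit Defensive.

Import Order.TTheory GRing.Theory Num.Theory.
Import numFieldNormedType.Exports.

Local Open Scope classical_set_scope.
Local Open Scope ring_scope.

(** The constant 18 is twice 9, and 9 is the length of the longest pattern
that avoids progressions.  Take 11 consecutive terms of a convex sequence
whose 10 slopes all have the same integer part m.  After subtraction of the
line of slope m, the floors form a lattice path with steps 0 and 1, that is, a
binary word of length 10, and convexity forbids most words.  Among the words
that survive, every one carries four equally spaced aligned points
([AP_convex_word], a finite verification; at length 9 it would fail for two
words, 001101101 and 010010011).  So such a window always yields a
progression ([floor_AP]), whose difference has a positive second component as
soon as the slopes are at least 1/3 ([window_AP]).

If all slopes of f are below 1, sampling f with a suitable step s brings the
slopes to at least 1/3, and still below 1, from some point on, and the window lemma applies with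
m = 0 ([bounded_slope_AP]).

Otherwise the slopes are eventually at least 1.  If there is no progression,
no 10 consecutive slopes have the same integer part, so the integer
part of the slope increases at least once every 9 steps ([slope_growth]).
Hence the slope grows at least like n / 9 and f(n) >= n^2 / 18 - O(n)
([quadratic_growth]), which bounds the limsup of N(x)^2 / x by 18
([limsup_count_le]).

Positive integers are shifted to t.+1 throughout, so that the convex sequence
fun t => f t.+1 is defined on all of nat and the unconstrained value f 0 never
enters. *)

(** * Convex sequences *)

Lemma telescopeE (R : realType) (F : nat -> R) (n : nat) :
  telescope F n = F n.+1 - F n.
Proof. by []. Qed.

Lemma chord_ge (R : realType) (F : nat -> R) :
  nondecreasing_seq (telescope F) ->
  forall a t : nat, t%:R * telescope F a <= F (a + t)%N - F a.
Proof.
move=> cvxF a; elim=> [|t IH]; first by rewrite addn0 subrr mul0r.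
have := cvxF a (a + t)%N (leq_addr _ _).
rewrite addnS -natr1 mulrDl mul1r [X in _ <= X -> _]telescopeE; lra.
Qed.

Lemma chord_le (R : realType) (F : nat -> R) :
  nondecreasing_seq (telescope F) ->
  forall a t : nat, F (a + t)%N - F a <= t%:R * telescope F (a + t)%N.
Proof.
move=> cvxF a; elim=> [|t IH]; first by rewrite addn0 subrr mul0r.
have h : telescope F (a + t)%N <= telescope F (a + t).+1 by exact: cvxF.
have ht : (0 : R) <= t%:R by [].
have := ler_wpM2l ht h.
rewrite addnS -natr1 mulrDl mul1r.
have := telescopeE F (a + t)%N.
lra.
Qed.

(** The slope at j separates the slope of the chord from i to j from that of
the chord from j to k. *)
Lemma three_chords (R : realType) (F : nat -> R) :
  nondecreasing_seq (telescope F) ->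
  forall i j k : nat, (i <= j <= k)%N ->
  (k - i)%:R * F j <= (k - j)%:R * F i + (j - i)%:R * F k.
Proof.
move=> cvxF i j k /andP[ij jk].
have h1 := chord_le cvxF i (j - i)%N.
have h2 := chord_ge cvxF j (k - j)%N.
rewrite subnKC // in h1; rewrite subnKC // in h2.
have -> : (k - i)%N = ((k - j) + (j - i))%N by lia.
rewrite natrD.
have p : (0 : R) <= (k - j)%:R by [].
have q : (0 : R) <= (j - i)%:R by [].
have := ler_wpM2l p h1; have := ler_wpM2l q h2; nra.
Qed.

Lemma convex_subsequence (R : realType) (F : nat -> R) (n s : nat) :
  nondecreasing_seq (telescope F) ->
  nondecreasing_seq (telescope (fun k => F (n + s * k)%N)).
Proof.
move=> cvxF; apply/nondecreasing_seqP => k; rewrite !telescopeE !mulnS.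
have := chord_le cvxF (n + s * k)%N s.
have := chord_ge cvxF (n + s * k + s)%N s.
have -> : (n + s * k + s = n + (s + s * k))%N by lia.
have -> : (n + (s + s * k) + s = n + (s + (s + s * k)))%N by lia.
lra.
Qed.

(** * Binary words of length ten *)

Fixpoint words (n : nat) : seq (seq bool) :=
  if n is n'.+1 then
    [seq true :: w | w <- words n'] ++ [seq false :: w | w <- words n']
  else [:: [::]].

Lemma mem_words (w : seq bool) : w \in words (size w).
Proof.
elim: w => // b w IH; rewrite /= mem_cat.
by case: b; rewrite (map_f (cons _) IH) ?orbT.
Qed.

Definition height (w : seq bool) (k : nat) : nat := count id (take k w).

(** If h i, h j, h k are the floors of the values of a convex function at
i < j < k, the chord inequality loses less than 1 at i and at k and nothing at
j; cleared of denominators, the total loss is less than k - i.  The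
inequality is written with additions only, as subtraction of naturals
truncates. *)
Definition convex_triple (h : nat -> nat) (i j k : nat) : bool :=
  ((k - i) * h j < (k - j) * h i + (j - i) * h k + (k - i))%N.

Definition convex_word (w : seq bool) : bool :=
  all (fun k => all (fun j => all (fun i => convex_triple (height w) i j k)
    (iota 0 j)) (iota 0 k)) (iota 0 (size w).+1).

(** Vanishing of the two second differences, with step d, of h at i and
i + d. *)
Definition flat4 (h : nat -> nat) (i d : nat) : bool :=
  (h i + h (i + d + d) == h (i + d) + h (i + d))%N &&
  (h (i + d) + h (i + d + d + d) == h (i + d + d) + h (i + d + d))%N.

Definition AP_word (w : seq bool) : bool :=
  has (fun d => has (fun i => flat4 (height w) i d)
    (iota 0 ((size w).+1 - 3 * d))) (iota 1 (size w %/ 3)).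

(** The cheap test comes first: the convexity test is then evaluated only on
the words without four equally spaced aligned points. *)
Lemma convex_words10 :
  all (fun w => AP_word w || ~~ convex_word w) (words 10).
Proof. by vm_compute. Qed.

Lemma AP_convex_word (w : seq bool) :
  size w = 10%N -> convex_word w -> AP_word w.
Proof.
move=> sw cw; have w10 := mem_words w; rewrite sw in w10.
by have /orP[] := allP convex_words10 w w10 => //; rewrite cw.
Qed.

(** * Progressions in a window of eleven points *)

(** The integers b k = floor (g k) - m k have steps 0 or 1 because the slopes
of g have integer part m, so they are the heights of a binary word; the chord
inequality for g makes this word convex. *)
Lemma floor_AP (R : realType) (g : nat -> R) (m : int) :
  nondecreasing_seq (telescope g) ->
  (forall k, (k < 10)%N -> m%:~R <= telescope g k < m%:~R + 1) ->
  exists i d (E : int), [/\ (0 < d)%N, (i + d + d + d <= 10)%N &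
    forall j, (j < 4)%N ->
      Num.floor (g (i + d * j)%N) = Num.floor (g i) + E *+ j].
Proof.
move=> cvxg slope.
pose b k : int := Num.floor (g k) - m * k%:Z.
have bE k : Num.floor (g k) = b k + m * k%:Z by rewrite /b subrK.
have b_le k : (b k)%:~R <= g k - m%:~R * k%:R.
  have := floor_le (g k); rewrite bE intrD intrM -pmulrn; lra.
have b_gt k : g k - m%:~R * k%:R < (b k)%:~R + 1.
  have := floorD1_gt (g k); rewrite bE !intrD intrM -pmulrn; lra.
pose w := mkseq (fun k => b k < b k.+1) 10.
have step k : (k < 10)%N -> b k.+1 = b k + (b k < b k.+1).
  move=> k10; have /andP[lo hi] := slope k k10; rewrite telescopeE in lo hi.
  have := b_le k; have := b_gt k; have := b_le k.+1; have := b_gt k.+1.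
  rewrite -natr1 mulrDr mulr1 => h1 h2 h3 h4.
  have : ((b k)%:~R : R) < (b k.+1 + 1)%:~R by rewrite intrD; lra.
  have : ((b k.+1)%:~R : R) < (b k + 2)%:~R by rewrite intrD; lra.
  rewrite !ltr_int; lia.
have [c bh] : exists c : int, forall k, (k <= 10)%N -> b k = c + height w k.
  exists (b 0%N) => k; elim: k => [|k IH] k10; first by rewrite /height take0 addr0.
  have sw : size w = 10%N by rewrite size_mkseq.
  rewrite step // IH; last by lia.
  rewrite /height (take_nth false) ?sw // -cats1 count_cat /=.
  by rewrite nth_mkseq // IH ?(ltnW k10) // addn0 PoszD addrA.
have sw : size w = 10%N by rewrite size_mkseq.
have cw : convex_word w.
  apply/allP => k; rewrite sw mem_iota => /andP[_ k11].
  apply/allP => j; rewrite mem_iota => /andP[_ jk].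
  apply/allP => i; rewrite mem_iota => /andP[_ ij].
  have := three_chords cvxg (i := i) (j := j) (k := k).
  rewrite (ltnW ij) (ltnW jk) => /(_ isT) tc.
  have := b_le j; have := b_gt i; have := b_gt k.
  rewrite !bh; [|lia..].
  rewrite !intrD -!pmulrn /convex_triple => hk hi hj.
  rewrite -(ltr_nat R) !natrD !natrM.
  have eki : ((k - i)%:R : R) = (k - j)%:R + (j - i)%:R.
    by rewrite -natrD; congr (_%:R); lia.
  have ek : (k%:R : R) = j%:R + (k - j)%:R.
    by rewrite -natrD; congr (_%:R); lia.
  have ej : (j%:R : R) = i%:R + (j - i)%:R.
    by rewrite -natrD; congr (_%:R); lia.
  have p : (0 : R) < (k - j)%:R by rewrite ltr0n; lia.
  have q : (0 : R) < (j - i)%:R by rewrite ltr0n; lia.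
  rewrite eki in tc *; rewrite ek in hk; rewrite ej in hk hj.
  move: p q tc hi hj hk; set P := (k - j)%:R; set Q := (j - i)%:R.
  move=> p q tc hi hj hk.
  rewrite -(ltr_pM2l p) in hi; rewrite -(ltr_pM2l q) in hk.
  have := ler_wpM2l (addr_ge0 (ltW p) (ltW q)) hj; lra.
have /hasP[d] := AP_convex_word sw cw.
rewrite sw mem_iota => /andP[d0 d4] /hasP[i].
rewrite mem_iota => /andP[_ i8] /andP[/eqP e1 /eqP e2].
exists i, d, (Num.floor (g (i + d)%N) - Num.floor (g i)).
have h10 : (i + d + d + d <= 10)%N by lia.
split=> // j j4; rewrite !bE.
rewrite (bh i) ?(bh (i + d)%N) ?(bh (i + d * j)%N); [|nia..].
have : j = 0%N \/ j = 1%N \/ j = 2%N \/ j = 3%N by lia.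
case=> [->|[->|[->|->]]].
- by rewrite muln0 addn0 mulr0n addr0.
- rewrite muln1 mulr1n; lia.
- have -> : (i + d * 2 = i + d + d)%N by lia.
  rewrite !PoszD; nia.
- have -> : (i + d * 3 = i + d + d + d)%N by lia.
  rewrite !PoszD; nia.
Qed.

Lemma pair_mulrn (U V : zmodType) (x : U) (y : V) (j : nat) :
  (x, y) *+ j = (x *+ j, y *+ j).
Proof. by elim: j => // j IH; rewrite !mulrS IH. Qed.

(** The bound 1/3 on the slopes makes the progression strictly increasing in
its second coordinate: over 3d steps the function grows by at least d >= 1,
so its floor cannot stay the same. *)
Lemma window_AP (R : realType) (f : nat -> R) (n s : nat) (m : int) :
  let g := fun k => f (n + s * k).+1 in
  nondecreasing_seq (telescope (fun t => f t.+1)) -> (0 < s)%N ->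
  1 <= f n.+1 -> 1 / 3 <= telescope g 0 ->
  (forall k, (k < 10)%N -> m%:~R <= telescope g k < m%:~R + 1) ->
  contains_AP 4 (floor_graph f).
Proof.
move=> g cvxf s0 fn slope0 slope.
have cvxg : nondecreasing_seq (telescope g).
  exact: (@convex_subsequence R (fun t => f t.+1)).
have [i [d [E [d0 le10 hE]]]] := floor_AP cvxg slope.
have g0 : 1 <= g 0%N by rewrite /g muln0 addn0.
have ge1 k : 1 <= g k.
  have := chord_ge cvxg 0 k; rewrite add0n.
  have : 0 <= k%:R * telescope g 0 by rewrite mulr_ge0 //; lra.
  lra.
have E0 : 0 < E.
  have := hE 3%N isT; have := chord_ge cvxg i (d * 3)%N.
  have slopei := cvxg 0%N i (leq0n i).
  have d1 : (1 : R) <= d%:R by rewrite ler1n.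
  have dn : (0 : R) <= (d * 3)%:R by [].
  have := ler_wpM2l dn (le_trans slope0 slopei).
  rewrite natrM => h1 h2 e.
  have : Num.floor (g i) + 1 <= Num.floor (g (i + d * 3)%N).
    by rewrite floor_ge_int intrD; have := floor_le (g i); lra.
  by rewrite e; lia.
pose x j := (n + s * (i + d * j))%N.
exists (fun j : 'I_4 => ((x j).+1%:Z, Num.floor (f (x j).+1))).
split; last by move=> j; exists (x j).+1.
split.
  move=> j; split => //=; apply: (@lt_le_trans _ _ 1) => //.
  by rewrite floor_ge_int; exact: (ge1 (i + d * j)%N).
exists ((x 0%N).+1%:Z, Num.floor (f (x 0%N).+1)), ((s * d)%N%:Z, E).
split; first by split=> //=; rewrite ltz_nat muln_gt0 s0.
move=> j; rewrite pair_mulrn.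
have -> : Num.floor (f (x j).+1) = Num.floor (f (x 0%N).+1) + E *+ j.
  by rewrite /x muln0 addn0; exact: (hE j (ltn_ord j)).
by congr (_, _); rewrite /x /= -mulr_natr natz muln0 addn0; nia.
Qed.

(** With s the least integer for which s times some slope reaches 1/3, the
products of s with the slopes stay below 1: for s = 1 by hypothesis, and for
s >= 2 because both s - 1 times a slope and the slope itself are below 1/3. *)
Lemma bounded_slope_AP (R : realType) (f : nat -> R) :
  nondecreasing_seq (telescope (fun t => f t.+1)) ->
  0 < f 1%N -> 0 < telescope (fun t => f t.+1) 0 ->
  (forall n, telescope (fun t => f t.+1) n < 1) ->
  contains_AP 4 (floor_graph f).
Proof.
set F := fun t => f t.+1 => cvxF f1 slope0 slope1.
have exs : exists s, `[< exists n, 1 / 3 <= s%:R * telescope F n >].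
  exists (Num.trunc (1 / telescope F 0)).+1; apply/asboolP; exists 0%N.
  have := truncnS_gt (1 / telescope F 0); rewrite ltr_pdivrMr //; lra.
case: (ex_minnP exs) => s /asboolP[n1 hn1] smin.
have s0 : (0 < s)%N by case: s hn1 {smin} => //; rewrite mul0r; lra.
have hs k : s%:R * telescope F k < 1.
  case: s s0 hn1 smin => // -[|s] _ hn1 smin; first by rewrite mul1r.
  have small t : (0 < t <= s.+1)%N -> t%:R * telescope F k < 1 / 3.
    move=> /andP[_ ts]; rewrite ltNge; apply/negP => ht.
    have : (s.+2 <= t)%N by apply: smin; apply/asboolP; exists k.
    by rewrite leqNgt ltnS ts.
  have := small 1%N isT; have := small s.+1; rewrite leqnn => /(_ isT).
  by rewrite -(natr1 s.+1) mulrDl mulr1n !mul1r; lra.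
have pos k : 0 < telescope F k by apply: lt_le_trans slope0 (cvxF _ _ _).
(* n is beyond n1, where the sampled slope reaches 1/3, and large enough for
   the increasing sequence F to have passed 1, so that the floors in the window
   are positive. *)
pose n := (n1 + Num.trunc (1 / telescope F 0)).+1.
have Fn : 1 <= F n.
  have := chord_ge cvxF 0 n; rewrite add0n.
  have : 1 / telescope F 0 <= n%:R.
    apply: ltW; apply: lt_le_trans (truncnS_gt _) _.
    by rewrite ler_nat ltnS leq_addl.
  have : 0 < F 0%N by [].
  by rewrite ler_pdivrMr //; lra.
have gap k : telescope (fun j => F (n + s * j)%N) k
    = F (n + s * k + s)%N - F (n + s * k)%N.
  by rewrite telescopeE mulnS (addnC s) addnA.
apply: (@window_AP R f n s 0) => //.
  rewrite gap muln0 addn0.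
  apply: le_trans (chord_ge cvxF n s); apply: le_trans hn1 _.
  by rewrite ler_wpM2l //; apply: cvxF; rewrite /n; lia.
move=> k _; rewrite gap; apply/andP; split.
  apply: le_trans (chord_ge cvxF _ _).
  by rewrite mulr_ge0 // ltW.
by apply: le_lt_trans (chord_le cvxF _ _) _; rewrite add0r.
Qed.

(** * Growth in the absence of progressions *)

(** Ten consecutive slopes cannot share the same integer part, by the window
lemma with s = 1, so each block of nine steps raises the integer part by at
least 1, starting from a value at least 1. *)
Lemma slope_growth (R : realType) (f : nat -> R) (n : nat) :
  let F := fun t => f t.+1 in
  nondecreasing_seq (telescope F) -> ~ contains_AP 4 (floor_graph f) ->
  1 <= F n -> 1 <= telescope F n ->
  forall t, t%:R <= 9 * telescope F (n + t)%N.
Proof.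
move=> F cvxF noAP Fn slopen.
have jump t : Num.floor (telescope F (n + t)%N) + 1
    <= Num.floor (telescope F (n + t + 9)%N).
  rewrite leNgt; apply/negP => lt9; apply: noAP.
  have slope1 : 1 <= telescope F (n + t)%N by apply: le_trans slopen (cvxF _ _ _); lia.
  have gap k : telescope (fun j => F (n + t + 1 * j)%N) k = telescope F (n + t + k)%N.
    by rewrite !telescopeE !mul1n addnS.
  apply: (@window_AP R f (n + t) 1 (Num.floor (telescope F (n + t)%N))) => //.
  - have : F (n + t)%N - F n <= f (n + t).+1 - F n by [].
    have : 0 <= t%:R * telescope F n by rewrite mulr_ge0 //; lra.
    by have := chord_ge cvxF n t; lra.
  - by rewrite gap addn0; lra.
  move=> k k10; rewrite gap; apply/andP; split.
    by apply: le_trans (floor_le _) (cvxF _ _ _); lia.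
  have le9 : telescope F (n + t + k)%N <= telescope F (n + t + 9)%N.
    by apply: cvxF; lia.
  apply: le_lt_trans le9 _; apply: lt_le_trans (floorD1_gt _) _.
  by rewrite intrD lerD2r ler_int -ltzD1.
have floors q : q.+1%:Z <= Num.floor (telescope F (n + 9 * q)%N).
  elim: q => [|q IH]; first by rewrite muln0 addn0 floor_ge_int.
  have := jump (9 * q)%N; rewrite -addnA -mulnSr; lia.
move=> t; have hq := floors (t %/ 9)%N; rewrite floor_ge_int in hq.
have le9 : telescope F (n + 9 * (t %/ 9))%N <= telescope F (n + t)%N.
  by apply: cvxF; lia.
have := le_trans hq le9.
have : (t%:R : R) <= (9 * (t %/ 9).+1)%:R by rewrite ler_nat; lia.
rewrite natrM -pmulrn; lra.
Qed.

Lemma quadratic_growth (R : realType) (f : nat -> R) (n : nat) :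
  let F := fun t => f t.+1 in
  0 <= F n -> (forall t, t%:R <= 9 * telescope F (n + t)%N) ->
  forall t, t%:R * (t%:R - 1) <= 18 * F (n + t)%N.
Proof.
move=> F Fn growth; elim=> [|t IH]; first by rewrite mul0r addn0; lra.
have := growth t; rewrite addnS telescopeE -natr1; nra.
Qed.

(** * The counting function *)

(** If f N > x for N = countN f x, monotonicity leaves at most N - 1 positive
integers n with f n <= x.  In that case the set counted is finite, so the
default value of the cardinal of an infinite set does no harm. *)
Lemma countN_le (R : realType) (f : nat -> R) (x : R) :
  nondecreasing_seq (fun t => f t.+1) ->
  (0 < countN f x)%N -> f (countN f x) <= x.
Proof.
move=> incf N0; rewrite leNgt; apply/negP => xN.
have := N0; set N := countN f x in N0 xN *.
suff : (N <= N.-1)%N by lia.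
rewrite {1}/N /countN; apply: geq_card_fset_set.
apply: (@card_le_trans _ _ _ (succn @` `I_N.-1)); last exact: card_image_le.
apply: subset_card_le => -[|k] [] //= _ fk; exists k => //=.
rewrite ltnNge; apply/negP => Nk.
have := incf N.-1 k Nk; rewrite /= prednK // => h; lra.
Qed.

(** If N = N(x) satisfies N^2 > (18 + e) x, then f N <= x and the quadratic
lower bound give e x < c N; reinserting this in N^2 <= 18 x + c N bounds N by
c + 18 c / e, and therefore bounds x. *)
Lemma limsup_count_le (R : realType) (f : nat -> R) (c : R) :
  0 <= c -> nondecreasing_seq (fun t => f t.+1) ->
  (forall n, (0 < n)%N -> n%:R ^+ 2 - c * n%:R <= 18 * f n) ->
  (limf_esup (fun x : R => ((countN f x)%:R ^+ 2 / x)%:E) (pinfty_nbhs R)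
    <= 18%:E)%E.
Proof.
move=> c0 incf quad; apply/lee_addgt0Pr => e e0.
pose K := c + 18 * c / e.
have K0 : 0 <= K by rewrite addr_ge0 // divr_ge0 ?mulr_ge0 // ltW.
pose B := c * K / e.
have B0 : 0 <= B by rewrite divr_ge0 ?mulr_ge0 // ltW.
rewrite limf_esupE; apply: ge_ereal_inf.
exists (ereal_sup [set ((countN f x)%:R ^+ 2 / x)%:E | x in `]B, +oo[%classic]).
  exists `]B, +oo[%classic => //; exists B; split; first exact: num_real.
  by move=> x; rewrite /= in_itv /= andbT.
apply: ge_ereal_sup => _ [x Bx <-].
rewrite /= in_itv /= andbT in Bx.
have x0 : 0 < x by lra.
rewrite -EFinD lee_fin ler_pdivrMr // leNgt; apply/negP => big.
have N0 : (0 < countN f x)%N.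
  rewrite lt0n; apply/negP => /eqP N0; move: big; rewrite N0 expr0n /=.
  have : 0 <= (18 + e) * x by rewrite mulr_ge0 //; lra.
  by lra.
have fN := countN_le incf N0; have := quad _ N0.
move: big; set N := (countN f x)%:R => big q.
have N1 : 0 < N by rewrite ltr0n.
have exN : e * x < c * N by nra.
have NK : N <= K.
  have : e * N <= e * c + 18 * c by nra.
  rewrite /K => h; rewrite -(ler_pM2l e0) mulrDr mulrCA divff ?gt_eqF //; lra.
have : c * N <= c * K by rewrite ler_wpM2l.
move: Bx; rewrite /B ltr_pdivrMr //; lra.
Qed.

Theorem theoremB3 (R : realType) (f : nat -> R)
  (f_gt0 : forall n : nat, (0 < n)%N -> 0 < f n)
  (Df_gt0 : forall n : nat, (0 < n)%N -> 0 < telescope f n)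
  (D2f_ge0 : forall n : nat, (0 < n)%N -> 0 <= telescope (telescope f) n)
  (limsup_gt : (18%:E < limf_esup
     (fun x : R => ((countN f x)%:R ^+ 2 / x)%:E) (pinfty_nbhs R))%E) :
  contains_AP 4 (floor_graph f).
Proof.
pose F := fun t => f t.+1.
have cvxF : nondecreasing_seq (telescope F).
  apply/nondecreasing_seqP => n; rewrite -subr_ge0; exact: (D2f_ge0 n.+1).
have incF : nondecreasing_seq F.
  apply/nondecreasing_seqP => n; rewrite -subr_ge0; apply: ltW.
  exact: (Df_gt0 n.+1).
have [slope1|] := pselect (forall n, telescope F n < 1).
  apply: bounded_slope_AP => //; [exact: f_gt0 | exact: (Df_gt0 1%N)].
move=> /existsNP[n1 /negP]; rewrite -leNgt => slope1.
apply: contrapT => noAP.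
have [n Fn slopen] : exists2 n, 1 <= F n & 1 <= telescope F n.
  exists n1.+1; last by apply: le_trans slope1 (cvxF _ _ _).
  have : 0 < F n1 by exact: f_gt0.
  by rewrite telescopeE in slope1; lra.
have quad := quadratic_growth (le_trans ler01 Fn) (slope_growth cvxF noAP Fn slopen).
move: limsup_gt; rewrite ltNge => /negP; apply.
apply: (@limsup_count_le R f (2 * n%:R + 3)) => //.
(* The constant 2 n + 3 comes from expanding t (t - 1) at t = k - n, for the
   index k.+1 of f; below n the left-hand side is not positive. *)
case=> // k _; have [nk|kn] := leqP n k.
  have := quad (k - n)%N; rewrite subnKC // natrB // -natr1 /F.
  have : (n%:R : R) <= k%:R by rewrite ler_nat.
  have : (0 : R) <= n%:R by [].
  nra.
have := f_gt0 k.+1 isT.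
have : (k.+1%:R : R) <= n%:R by rewrite ler_nat.
have : (0 : R) <= k.+1%:R by [].
nra.
Qed.
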